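(* Let $\Delta v>0$, let $v_0<v_1<\dots<v_N$ be a uniform grid with $v_{i+1}-v_i=\Delta v$, let $M\ge 0$ be an integer, and let $D_{i+1/2}>0$ for $i=0,\dots,N-1$. For each $h=0,\dots,M$ let $\hat f^\infty_{h,i}>0$ ($i=0,\dots,N$) be the grid values of the stationary state, and let $\hat f_{h,i}(t)>0$ ($i=0,\dots,N$, $t\ge 0$) be a solution of the conservative semi-discrete scheme $$\frac{d}{dt}\hat f_{h,i}(t)=\frac{\mathcal F_{h,i+1/2}(t)-\mathcal F_{h,i-1/2}(t)}{\Delta v},\qquad i=0,\dots,N,$$ with no-flux boundary conditions $\mathcal F_{h,-1/2}(t)=\mathcal F_{h,N+1/2}(t)=0$ and, for $i=0,\dots,N-1$, the structure preserving flux $$\mathcal F_{h,i+1/2}(t)=\tilde{\mathcal C}_{i+1/2}\big[(1-\delta_{i+1/2})\hat f_{h,i+1}(t)+\delta_{i+1/2}\hat f_{h,i}(t)\big]+D_{i+1/2}\frac{\hat f_{h,i+1}(t)-\hat f_{h,i}(t)}{\Delta v},$$ where $$\tilde{\mathcal C}_{i+1/2}=\frac{D_{i+1/2}}{\Delta v}\lambda_{i+1/2},\qquad \delta_{i+1/2}=\frac1{\lambda_{i+1/2}}+\frac1{1-\exp(\lambda_{i+1/2})},\qquad \lambda_{i+1/2}=\log\Big(\frac{\hat f^\infty_{h,i}}{\hat f^\infty_{h,i+1}}\Big).$$ Then for every $h=0,\dots,M$ and all $t\ge 0$ the discrete entropy dissipation $$\frac{d}{dt}\mathcal H_{\Delta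 v}(\hat f_h,\hat f_h^\infty)(t)=-\mathcal I_{\Delta v}(\hat f_h,\hat f_h^\infty)(t)$$ holds, where $$\mathcal H_{\Delta v}(\hat f_h,\hat f_h^\infty)(t)=\Delta v\sum_{i=0}^N\hat f_{h,i}(t)\log\Big(\frac{\hat f_{h,i}(t)}{\hat f^\infty_{h,i}}\Big)$$ and $$\mathcal I_{\Delta v}(\hat f_h,\hat f_h^\infty)(t)=\sum_{i=0}^{N-1}\Big[\log\Big(\frac{\hat f_{h,i+1}(t)}{\hat f^\infty_{h,i+1}}\Big)-\log\Big(\frac{\hat f_{h,i}(t)}{\hat f^\infty_{h,i}}\Big)\Big]\cdot\Big(\frac{\hat f_{h,i+1}(t)}{\hat f^\infty_{h,i+1}}-\frac{\hat f_{h,i}(t)}{\hat f^\infty_{h,i}}\Big)\,\bar f^\infty_{h,i+1/2}\,D_{i+1/2}\ \ge 0,$$ with $$\bar f^\infty_{h,i+1/2}=\frac{\hat f^\infty_{h,i+1}\hat f^\infty_{h,i}}{\hat f^\infty_{h,i+1}-\hat f^\infty_{h,i}}\log\Big(\frac{\hat f^\infty_{h,i+1}}{\hat f^\infty_{h,i}}\Big).$$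
   Context: Conventions: when $\hat f^\infty_{h,i+1}=\hat f^\infty_{h,i}$ (i.e. $\lambda_{i+1/2}=0$) the expressions for $\delta_{i+1/2}$ and $\bar f^\infty_{h,i+1/2}$ are understood as their limits, namely $\delta_{i+1/2}=\tfrac12$ and $\bar f^\infty_{h,i+1/2}=\hat f^\infty_{h,i}$. Background: the scheme discretizes the stochastic Galerkin system $\partial_t\hat f_h=\partial_v[\mathcal B[g](v)\hat f_h+\partial_v(D(v)\hat f_h)]$, $h=0,\dots,M$, with a fixed (time-independent) background $g$ and $\mathcal B[g](v)=\int_V P(v,v_* )(v-v_* )g(v_* )\,dv_*$. Its stationary states satisfy $\mathcal B[g]\hat f_h^\infty+\partial_v(D\hat f_h^\infty)=0$, so that $$\frac{\hat f^\infty_{h,i+1}}{\hat f^\infty_{h,i}}=\exp(-\lambda_{i+1/2}),\qquad \lambda_{i+1/2}=\int_{v_i}^{v_{i+1}}\frac{\mathcal B[g](v)+D'(v)}{D(v)}\,dv .$$ In particular $\lambda_{i+1/2}$ does not depend on $h$. Here $\hat f_{h,i}(t)$ approximates $\hat f_h(v_i,t)$, $\hat f^\infty_{h,i}=\hat f^\infty_h(v_i)$ and $D_{i+1/2}=D(v_i+\Delta v/2)$.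
   Formalization: The printed identity dH/dt = -I is false unless Δv = 1 (or I = 0), as a factor 1/Δv is missing; the formal theorem proves dH/dt = -(1/Δv) I with H and I exactly as printed, together with I ≥ 0. *)

(* Defs.v *)
From HB Require Import structures.
From mathcomp Require Import all_boot all_order all_algebra.
From mathcomp Require Import all_classical all_reals all_analysis.

Set Implicit Arguments.
Unset Strict Implicit.
Unset Printing Implicit Defensive.

Import Order.TTheory GRing.Theory Num.Theory.
Import numFieldNormedType.Exports.

Local Open Scope classical_set_scope.
Local Open Scope ring_scope.

(* Derivative relative to a set A: for A = `[0, +oo[ it is the usual two-sided
   derivative at t > 0 and the right derivative at t = 0, so that nothing is
   said about the values of f at negative times. *)
Definition is_derive_within (R : realType) (A : set R) (f : R -> R) (t l : R)
    : Prop :=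
  (fun s => (f s - f t) / (s - t)) @ within A t^' --> l.

(* A grid with the N + 1 nodes v_0, ..., v_N has N interior interfaces; the
   interface i + 1/2 is indexed by i : 'I_N. *)

(* The node i of the interface i + 1/2: [lift ord_max] preserves the value. *)
Definition nodeL (N : nat) (i : 'I_N) : 'I_N.+1 := lift ord_max i.
(* The node i + 1 of the interface i + 1/2: [lift ord0] is the successor. *)
Definition nodeR (N : nat) (i : 'I_N) : 'I_N.+1 := lift ord0 i.

Section Scheme.
Variables (R : realType) (N : nat) (dv : R).

(* The Chang-Cooper weight delta, extended by its limit at lam = 0. *)
Definition weight (lam : R) : R :=
  if lam == 0 then 2^-1 else lam^-1 + (1 - expR lam)^-1.

Definition drift (D lam : R) : R := D / dv * lam.

Definition flux (D lam : 'I_N -> R) (u : 'I_N.+1 -> R) (i : 'I_N) : R :=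
  drift (D i) (lam i) *
    ((1 - weight (lam i)) * u (nodeR i) + weight (lam i) * u (nodeL i))
  + D i * ((u (nodeR i) - u (nodeL i)) / dv).

(* F_{i+1/2} seen from the node i, with F_{N+1/2} = 0 at i = N. *)
Definition flux_right (D lam : 'I_N -> R) (u : 'I_N.+1 -> R) (i : 'I_N.+1) : R :=
  if unlift ord_max i is Some j then flux D lam u j else 0.
(* F_{i-1/2} seen from the node i, with F_{-1/2} = 0 at i = 0. *)
Definition flux_left (D lam : 'I_N -> R) (u : 'I_N.+1 -> R) (i : 'I_N.+1) : R :=
  if unlift ord0 i is Some j then flux D lam u j else 0.

Definition is_scheme_solution (D lam : 'I_N -> R) (u : 'I_N.+1 -> R -> R) : Prop :=
  forall (i : 'I_N.+1) (t : R), 0 <= t ->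
    is_derive_within `[0, +oo[ (u i) t
      ((flux_right D lam (u ^~ t) i - flux_left D lam (u ^~ t) i) / dv).

Definition entropy (u uinf : 'I_N.+1 -> R) : R :=
  dv * \sum_(i < N.+1) u i * ln (u i / uinf i).

(* The interface value of the stationary state between a = uinf_i and
   b = uinf_{i+1}, extended by its limit at a = b. *)
Definition interface_mean (a b : R) : R :=
  if a == b then a else b * a / (b - a) * ln (b / a).

(* No factor 1/dv is included here: the flux equals
   D_i / dv * interface_mean * (difference of u / uinf), so the entropy identity
   reads dH/dt = - dissipation / dv. *)
Definition dissipation (D : 'I_N -> R) (u uinf : 'I_N.+1 -> R) : R :=
  \sum_(i < N)
    (ln (u (nodeR i) / uinf (nodeR i)) - ln (u (nodeL i) / uinf (nodeL i)))
    * (u (nodeR i) / uinf (nodeR i) - u (nodeL i) / uinf (nodeL i))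
    * interface_mean (uinf (nodeL i)) (uinf (nodeR i)) * D i.

End Scheme.

(* Main.v *)
(** The weights are chosen so that the flux is a positive multiple of the
    difference of [u / uinf] across the interface:
    [F_{i+1/2} = D_i / dv * mean(uinf_i, uinf_{i+1}) * (g_{i+1} - g_i)] with
    [g = u / uinf].  The derivative of [x ln (x / c)] is [ln (x / c) + 1], so
    differentiating the entropy along the scheme and summing by parts (no
    boundary term, by the no-flux condition) gives
    [- \sum_i (ln g_{i+1} - ln g_i) F_{i+1/2}], which is nonpositive because
    [ln] is nondecreasing. *)

Require Import Defs.
From HB Require Import structures.
From mathcomp Require Import all_boot all_order all_algebra.
From mathcomp Require Import all_classical all_reals all_analysis.
From mathcomp Require Import ring.

Set Implicit Arguments.
Unset Strict Implicit.
Unset Printing Implicit Defensive.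

Import Order.TTheory GRing.Theory Num.Theory.
Import numFieldNormedType.Exports.

Local Open Scope classical_set_scope.
Local Open Scope ring_scope.

(** Carathéodory's factor [phi], continuous at [f t], makes the difference quotient of [g \o f]
    equal to [phi (f s)] times that of [f]; nothing is divided by [f s - f t], which may vanish. *)
Lemma is_derive_within_comp (R : realType) (A : set R) (f g : R -> R)
    (t l m : R) :
  is_derive_within A f t l -> is_derive (f t) 1 g m ->
  is_derive_within A (g \o f) t (m * l).
Proof.
move=> df /is_derive1_caratheodory[phi [gE phi_cont <-]].
(* Off [t], [f s] is [f t] plus the difference quotient times [s - t], and this product tends to
   [l * 0]. *)
have f_cont : f s @[s --> within A t^'] --> f t.
  have st0 : s - t @[s --> within A t^'] --> 0.
    rewrite -(subrr t); apply: cvgB; last exact: cvg_cst.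
    by apply: cvg_within_filter; exact: nbhs_dnbhs.
  rewrite -[f t]addr0 -(mulr0 l).
  apply: cvg_trans (cvgD (cvg_cst (f t)) (cvgM df st0)).
  apply: near_eq_cvg; apply: cvg_within; near=> s.
  rewrite !fctE /= divfK ?subrKC// subr_eq0.
  by near: s; exact: nbhs_dnbhs_neq.
rewrite /is_derive_within.
under eq_cvg do rewrite /comp gE -mulrA.
by apply: cvgM => //; exact: continuous_cvg.
Unshelve. all: by end_near. Qed.

Lemma is_derive_within_sum (R : realType) (I : Type) (r : seq I) (A : set R)
    (f : I -> R -> R) (t : R) (l : I -> R) :
  (forall i, is_derive_within A (f i) t (l i)) ->
  is_derive_within A (fun s => \sum_(i <- r) f i s) t (\sum_(i <- r) l i).
Proof.
move=> df.
have dfE :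
    (fun s => (\sum_(i <- r) f i s - \sum_(i <- r) f i t) / (s - t)) =
    \sum_(i <- r) (fun s => (f i s - f i t) / (s - t)).
  by apply/funext => s; rewrite fct_sumE -sumrB mulr_suml.
rewrite /is_derive_within dfE.
by apply: (big_rec2 (fun F k => F @ within A t^' --> k)) => [|i k F _ Fk];
  [exact: cvg_cst | exact: cvgD (df i) Fk].
Qed.

Lemma is_derive_withinZ (R : realType) (A : set R) (f : R -> R) (k t l : R) :
  is_derive_within A f t l ->
  is_derive_within A (fun s => k * f s) t (k * l).
Proof.
move=> df; rewrite /is_derive_within.
under eq_cvg do rewrite -mulrBr -mulrA.
by apply: cvgM => //; exact: cvg_cst.
Qed.

Lemma is_derive_mul_ln_div (R : realType) (c x : R) : 0 < c -> 0 < x ->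
  is_derive x 1 (fun y => y * ln (y / c)) (ln (x / c) + 1).
Proof.
move=> c_gt0 x_gt0.
have ddiv : is_derive x 1 ( *%R^~ c^-1) c^-1.
  under [X in is_derive _ _ X _]eq_fun do rewrite mulrC.
  rewrite -[X in is_derive _ _ _ X]mulr1.
  exact: (is_deriveZ c^-1 (is_derive_id x 1)).
have dln : is_derive x 1 (@ln R \o *%R^~ c^-1) ((x / c)^-1 * c^-1).
  by apply: is_derive1_comp; apply: is_derive1_ln; rewrite divr_gt0.
apply: is_derive_eq (is_deriveM (is_derive_id x 1) dln) _.
rewrite /GRing.scale/= mulr1 addrC; congr (_ + _); field.
by rewrite !gt_eqF.
Qed.

Lemma subr_ln_mul_ge0 (R : realType) (x y : R) : 0 < x -> 0 < y ->
  0 <= (ln x - ln y) * (x - y).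
Proof.
move=> x_gt0 y_gt0; case: (leP x y) => xy.
  by rewrite mulr_le0// subr_le0 // ler_ln.
by rewrite mulr_ge0// subr_ge0 ?ler_ln// ltW.
Qed.

Lemma interface_mean_ge0 (R : realType) (a b : R) : 0 < a -> 0 < b ->
  0 <= interface_mean a b.
Proof.
move=> a_gt0 b_gt0; rewrite /interface_mean; case: eqVneq => [_|ab].
  exact: ltW.
have ba0 : b - a != 0 by rewrite subr_eq0 eq_sym.
(* Multiplying and dividing by [b - a] isolates a product of two differences of equal sign. *)
have -> : b * a / (b - a) * ln (b / a) =
    b * a / (b - a) ^+ 2 * ((ln b - ln a) * (b - a)).
  by rewrite ln_div ?posrE//; field.
by rewrite mulr_ge0 ?subr_ln_mul_ge0// divr_ge0 ?sqr_ge0// mulr_ge0 ?ltW.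
Qed.

Lemma dissipation_ge0 (R : realType) (N : nat) (D : 'I_N -> R)
    (u uinf : 'I_N.+1 -> R) :
  (forall i, 0 <= D i) -> (forall i, 0 < u i) -> (forall i, 0 < uinf i) ->
  0 <= dissipation D u uinf.
Proof.
move=> D_ge0 u_gt0 uinf_gt0; apply: sumr_ge0 => i _.
by rewrite mulr_ge0// mulr_ge0 ?interface_mean_ge0// subr_ln_mul_ge0// divr_gt0.
Qed.

(** Write [a], [b] for the left and right values of [uinf], and [L = ln (a / b)]. As
    [expR L = a / b], for [a != b] the weight is [L^-1 + b / (b - a)]. Its [L^-1] part turns the
    drift into a term that cancels the diffusion; the rest is [- L / (b - a) * (a * u_R - b * u_L)]
    times [D i / dv]. *)
Lemma fluxE (R : realType) (N : nat) (dv : R) (D lam : 'I_N -> R)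
    (u uinf : 'I_N.+1 -> R) (i : 'I_N) :
  0 < uinf (nodeL i) -> 0 < uinf (nodeR i) ->
  lam i = ln (uinf (nodeL i) / uinf (nodeR i)) ->
  flux dv D lam u i =
    D i / dv * interface_mean (uinf (nodeL i)) (uinf (nodeR i)) *
    (u (nodeR i) / uinf (nodeR i) - u (nodeL i) / uinf (nodeL i)).
Proof.
move=> a_gt0 b_gt0 lamE; rewrite /flux /drift /weight /interface_mean lamE.
move: (uinf (nodeL i)) (uinf (nodeR i)) a_gt0 b_gt0 => a b a_gt0 b_gt0 {lamE}.
have ab_gt0 : 0 < a / b by rewrite divr_gt0.
rewrite ln_eq0// lnK ?posrE//.
rewrite -[b / a]invf_div lnV ?posrE//.
have a0 : a != 0 by rewrite gt_eqF.
have b0 : b != 0 by rewrite gt_eqF.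
have -> : (a / b == 1) = (a == b) by rewrite -(inj_eq (mulIf b0)) divfK// mul1r.
(* For [a = b] the drift vanishes and only the diffusion remains. *)
case: eqVneq => [->|ab].
  by rewrite divff// ln1; move: (dv^-1) => k; field.
have L0 : ln (a / b) != 0.
  by rewrite ln_eq0// -(inj_eq (mulIf b0)) divfK// mul1r.
have ba0 : b - a != 0 by rewrite subr_eq0 eq_sym.
(* With the logarithm as an atom, the claim is a rational identity. *)
move: (ln _) L0 (dv^-1) => L L0 k; field.
by rewrite a0 b0 L0 ba0.
Qed.

Lemma sum_flux_by_parts (R : realType) (N : nat) (dv : R) (D lam : 'I_N -> R)
    (u w : 'I_N.+1 -> R) :
  \sum_i w i * (flux_right dv D lam u i - flux_left dv D lam u i) =
  - \sum_(i < N) (w (nodeR i) - w (nodeL i)) * flux dv D lam u i.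
Proof.
under eq_bigr do rewrite mulrBr.
(* Right fluxes lose the last node and left fluxes the first, both by no-flux; each remaining sum
   runs over the interfaces. *)
rewrite sumrB (bigD1_ord ord_max)//= [X in _ - X](bigD1_ord ord0)//=.
rewrite /flux_right /flux_left !unlift_none !mulr0 !add0r.
rewrite -sumrB -sumrN; apply: eq_bigr => i _.
by rewrite !liftK mulrBl opprB.
Qed.

Theorem theorem5 (R : realType) (N M : nat) (dv : R) (v : 'I_N.+1 -> R)
    (D lambda : 'I_N -> R)
    (finf : 'I_M.+1 -> 'I_N.+1 -> R)
    (f : 'I_M.+1 -> 'I_N.+1 -> R -> R)
    (dv_gt0 : 0 < dv)
    (v_uniform : forall i : 'I_N, v (nodeR i) - v (nodeL i) = dv)
    (D_gt0 : forall i, 0 < D i)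
    (finf_gt0 : forall h i, 0 < finf h i)
    (lambdaE : forall h i, lambda i = ln (finf h (nodeL i) / finf h (nodeR i)))
    (f_gt0 : forall h i (t : R), 0 <= t -> 0 < f h i t)
    (f_scheme : forall h, is_scheme_solution dv D lambda (f h)) :
  forall (h : 'I_M.+1) (t : R), 0 <= t ->
    is_derive_within `[0, +oo[ (fun s => entropy dv (f h ^~ s) (finf h)) t
      (- (dv^-1 * dissipation D (f h ^~ t) (finf h)))
    /\ 0 <= dissipation D (f h ^~ t) (finf h).
Proof.
move=> h t t_ge0; split; last first.
  by apply: dissipation_ge0 => i //; [exact: ltW | exact: f_gt0].
have dH := is_derive_withinZ (k := dv)
  (is_derive_within_sum (r := index_enum 'I_N.+1)
  (fun i => is_derive_within_comp (f_scheme h i t t_ge0)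
     (is_derive_mul_ln_div (finf_gt0 h i) (f_gt0 h i t t_ge0)))).
congr is_derive_within: dH.
under eq_bigr do rewrite mulrA.
(* Here [w] is [ln (u / uinf) + 1], whose constant drops out of the differences. The entropy's [dv]
   cancels the scheme's; the surviving [dv^-1] comes from the flux. *)
rewrite -mulr_suml sum_flux_by_parts mulrC divfK ?gt_eqF//.
congr (- _); rewrite /dissipation mulr_sumr; apply: eq_bigr => i _.
rewrite (fluxE dv D _ (finf_gt0 h _) (finf_gt0 h _) (lambdaE h i)).
ring.
Qed.
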